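(* Let $n\ge 1$, let $X$ be an $n\times n$ matrix with real (or rational) entries, let $s,t$ be scalars (or commuting indeterminates), and let $I$ denote the $n\times n$ identity matrix. Then for every $0\le \ell\le n$ and all $\ell$-subsets $\mathrm{S},\mathrm{T}\subseteq[n]$, $$\left((sI+tX)^{\vee\ell}\right)_{\mathrm{S}\mathrm{T}}=\sum_{0\le j\le \ell} s^{\ell-j}t^{j}\sum_{\substack{\mathrm{A}\subseteq \mathrm{S}\cap\mathrm{T}\\ |\mathrm{A}|=\ell-j}}\left(X^{\vee j}\right)_{\mathrm{S}\setminus\mathrm{A},\,\mathrm{T}\setminus\mathrm{A}}.$$
   Context: $[n]=\{1,\dots,n\}$. For an $n\times n$ matrix $Y$ and $0\le k\le n$, the $k$-th zeon power $Y^{\vee k}$ is the $\binom nk\times\binom nk$ matrix whose rows and columns are indexed by the $k$-subsets of $[n]$, with $(Y^{\vee k})_{\mathrm{B}\mathrm{C}}$ equal to the permanent of the $k\times k$ submatrix of $Y$ with row set $\mathrm{B}$ and column set $\mathrm{C}$ (rows and columns taken in increasing order). For $k=0$, $Y^{\vee 0}$ is the $1\times 1$ matrix with entry $1$ (indexed by the empty set). Equivalently, $Y^{\vee k}$ is the matrix of the action induced by $Y$ on the degree-$k$ part of the zeon algebra generated by commuting $e_1,\dots,e_n$ with $e_i^2=0$. *)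

(* Defs.v *)
From mathcomp Require Import all_boot all_order all_fingroup all_algebra.

Set Implicit Arguments.
Unset Strict Implicit.
Unset Printing Implicit Defensive.

Import GRing.Theory.
Local Open Scope ring_scope.

(* [n] = {1, ..., n} is represented by 'I_n = {0, ..., n - 1}. *)
Definition ksubset (n k : nat) := {B : {set 'I_n} | #|B| == k}.

Lemma card_ksubset n k : #|{: ksubset n k}| = 'C(n, k).
Proof.
by rewrite card_sig -[in RHS](card_ord n) -card_draws; apply: eq_card => B; rewrite !inE.
Qed.

(* enum lists a subset of 'I_n by increasing values, see ksubset_nth_mono. *)
Definition ksubset_nth n k (B : ksubset n k) (i : 'I_k) : 'I_n :=
  enum_val (cast_ord (esym (eqP (valP B))) i).

Lemma mem_ksubset_nth n k (B : ksubset n k) (i : 'I_k) :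
  ksubset_nth B i \in val B.
Proof. exact: enum_valP. Qed.

Lemma ksubset_nth_mono n k (B : ksubset n k) (i j : 'I_k) :
  (i < j)%N -> (ksubset_nth B i < ksubset_nth B j)%N.
Proof.
move=> lt_ij; rewrite /ksubset_nth !(enum_val_nth (ksubset_nth B i)) /=.
have szB : size (enum (val B)) = k by rewrite -cardE (eqP (valP B)).
have srt : sorted (fun x y : 'I_n => (x < y)%N) (enum (val B)).
  rewrite {1}/enum_mem; apply: sorted_filter; first by move=> ? ? ?; apply: ltn_trans.
  by rewrite -enumT -[sorted _ _]/(sorted (relpre val ltn) (enum 'I_n)) -sorted_map val_enum_ord iota_ltn_sorted.
by apply: (sorted_ltn_nth _ _ srt) => //; rewrite ?inE ?szB// => ? ? ?; apply: ltn_trans.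
Qed.

Definition permanent (R : comNzRingType) (k : nat) (A : 'M[R]_k) : R :=
  \sum_(p : 'S_k) \prod_(i < k) A i (p i).

(* Rows and columns are numbered through enum_rank : ksubset n k -> 'I_#|_|;
   by card_ksubset this is a 'C(n, k) x 'C(n, k) matrix. *)
Definition zeon_power (R : comNzRingType) (n k : nat) (Y : 'M[R]_n) :
    'M[R]_#|{: ksubset n k}| :=
  \matrix_(i, j)
    permanent (mxsub (ksubset_nth (enum_val i)) (ksubset_nth (enum_val j)) Y).

(* The entry of Y^{\vee k} at row B and column C, for plain sets B and C. The
   value 0 is a dummy for B or C not of cardinality k; see zeon_entryE. *)
Definition zeon_entry (R : comNzRingType) (n k : nat) (Y : 'M[R]_n)
    (B C : {set 'I_n}) : R :=
  match insub B : option (ksubset n k), insub C : option (ksubset n k) with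
  | Some b, Some c => zeon_power k Y (enum_rank b) (enum_rank c)
  | _, _ => 0
  end.

Lemma zeon_entryE (R : comNzRingType) (n k : nat) (Y : 'M[R]_n)
    (B C : ksubset n k) :
  zeon_entry k Y (val B) (val C) =
  permanent (mxsub (ksubset_nth B) (ksubset_nth C) Y).
Proof. by rewrite /zeon_entry !valK mxE !enum_rankK. Qed.

(* Main.v *)
(* A bijection of S onto T is encoded as a self-map f of [n] with f @: S = T
   that is the identity off S. The permanents then become sums over such f, and
   expanding the product of the s [f i = i] + t X_(i, f i) over i in S chooses
   the subset A of S on which s is taken; only the A fixed pointwise by f
   contribute. The point is that the maps f encoding bijections of S onto T and
   fixing A pointwise are exactly those encoding bijections of S \ A onto
   T \ A. *)
Require Import Defs.
From mathcomp Require Import all_boot all_order all_fingroup all_algebra.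

Set Implicit Arguments.
Unset Strict Implicit.
Unset Printing Implicit Defensive.

Import GRing.Theory.
Local Open Scope ring_scope.

(** Fixing every point off [B] makes the encoding unique, so each bijection is counted once.
    Injectivity on [B] comes from [f @: B = C] when [#|B| = #|C|]. *)
Definition maps_onto (I : finType) (B C : {set I}) (f : {ffun I -> I}) :=
  (f @: B == C) && [forall x, (x \notin B) ==> (f x == x)].

Lemma maps_ontoP (I : finType) (B C : {set I}) (f : {ffun I -> I}) :
  reflect (f @: B = C /\ forall x, x \notin B -> f x = x) (maps_onto B C f).
Proof.
apply: (iffP andP) => [[/eqP fB /forallP fid]|[fB fid]]; split=> //.
- by move=> x xB; have := fid x; rewrite xB => /eqP.
- exact/eqP.
- by apply/forallP=> x; apply/implyP=> /fid->.
Qed.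

(** For [#|B| = #|C|] this is the permanent of the submatrix with rows [B] and columns [C], free of
    any numbering of the two sets. *)
Definition bijection_sum (R : comNzRingType) (I : finType) (Y : I -> I -> R)
    (B C : {set I}) : R :=
  \sum_(f | maps_onto B C f) \prod_(i in B) Y i (f i).

(** From left to right, [A] lies off [S :\: A], so it is fixed, and adding it back gives the image
    [T]. Conversely, equal cardinalities make [f] injective on [S], so no point of [S :\: A] can
    land in [A], whose points are already their own images. *)
Lemma maps_onto_setD (I : finType) (A S T : {set I}) (f : {ffun I -> I}) :
    #|S| = #|T| -> A \subset S :&: T ->
  maps_onto (S :\: A) (T :\: A) f =
  maps_onto S T f && [forall x in A, f x == x].
Proof.
move=> cST; rewrite subsetI => /andP[sAS sAT].
apply/maps_ontoP/andP=> [[fSA fid]|[/maps_ontoP[fS fid] /forall_inP fA]].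
  have fA x : x \in A -> f x = x by move=> xA; rewrite fid // inE xA.
  split; last by apply/forall_inP=> x /fA->.
  apply/maps_ontoP; split=> [|x xS]; last by rewrite fid // inE negb_and xS orbT.
  rewrite -(setID S A) imsetU fSA (setIidPr sAS) (eq_in_imset fA) imset_id.
  by rewrite -[in RHS](setID T A) (setIidPr sAT).
have injf : {in S &, injective f} by apply/imset_injP; rewrite fS cST.
split=> [|x]; last first.
  by rewrite inE negb_and negbK => /orP[/fA/eqP|/fid].
rewrite -fS; apply/setP=> y; rewrite inE.
apply/imsetP/andP=> [[x]|[yA /imsetP[x xS yx]]].
  rewrite inE => /andP[xA xS] ->; split; last exact: imset_f.
  apply: contra xA => fxA; have <- // : f x = x.
  by apply: injf; [exact: (subsetP sAS) | | exact/eqP/fA].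
exists x => //; rewrite inE xS andbT; apply: contra yA => xA.
by rewrite yx (eqP (fA _ xA)).
Qed.

Lemma ksubset_nth_inj n k (B : ksubset n k) : injective (ksubset_nth B).
Proof. by move=> i j /enum_val_inj/cast_ord_inj. Qed.

Lemma ksubset_nth_onto n k (B : ksubset n k) x :
  x \in val B -> exists i, ksubset_nth B i = x.
Proof.
move=> xB; exists (cast_ord (eqP (valP B)) (enum_rank_in xB x)).
by rewrite /ksubset_nth cast_ordK enum_rankK_in.
Qed.

Lemma big_ksubset (R : comNzRingType) n k (B : ksubset n k) (F : 'I_n -> R) :
  \prod_(x in val B) F x = \prod_(i < k) F (ksubset_nth B i).
Proof.
have -> : val B = ksubset_nth B @: 'I_k.
  apply/setP=> x; apply/idP/imsetP=> [/ksubset_nth_onto[i <-]|[i _ ->]].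
    by exists i.
  exact: mem_ksubset_nth.
by rewrite big_imset //= => i j _ _; apply: ksubset_nth_inj.
Qed.

Section PermutationMaps.
Variables (n k : nat) (B C : ksubset n k).

Definition map_of_perm (p : 'S_k) : {ffun 'I_n -> 'I_n} :=
  [ffun x => if [pick i | ksubset_nth B i == x] is Some i
             then ksubset_nth C (p i) else x].

Lemma map_of_perm_nth p i :
  map_of_perm p (ksubset_nth B i) = ksubset_nth C (p i).
Proof.
rewrite ffunE; case: pickP => [j /eqP/ksubset_nth_inj->//|/(_ i)].
by rewrite eqxx.
Qed.

Lemma map_of_perm_out p x : x \notin val B -> map_of_perm p x = x.
Proof.
move=> xB; rewrite ffunE; case: pickP => // i /eqP ix.
by rewrite -ix mem_ksubset_nth in xB.
Qed.

Lemma map_of_perm_inj : injective map_of_perm.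
Proof.
move=> p q pq; apply/permP=> i; apply: (@ksubset_nth_inj _ _ C).
by rewrite -!map_of_perm_nth pq.
Qed.

Lemma map_of_perm_onto p : maps_onto (val B) (val C) (map_of_perm p).
Proof.
apply/maps_ontoP; split; last exact: map_of_perm_out.
apply/setP=> y; apply/imsetP/idP=> [[x /ksubset_nth_onto[i <-] ->]|].
  by rewrite map_of_perm_nth mem_ksubset_nth.
case/ksubset_nth_onto=> j <-; exists (ksubset_nth B (p^-1%g j)).
  exact: mem_ksubset_nth.
by rewrite map_of_perm_nth permKV.
Qed.

(** The position in [C] of the image of the [i]-th element of [B] is an injective function of [i],
    hence a permutation of ['I_k]. *)
Lemma maps_onto_perm f :
  maps_onto (val B) (val C) f -> exists p, map_of_perm p = f.
Proof.
case/maps_ontoP=> fB fid.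
have injf : {in val B &, injective f}.
  by apply/imset_injP; rewrite fB (eqP (valP B)) (eqP (valP C)).
have fC i : exists j, ksubset_nth C j == f (ksubset_nth B i).
  have [|j <-] := @ksubset_nth_onto _ _ C (f (ksubset_nth B i)).
    by rewrite -fB imset_f ?mem_ksubset_nth.
  by exists j.
pose g i := xchoose (fC i).
have gE i : ksubset_nth C (g i) = f (ksubset_nth B i).
  exact/eqP/(xchooseP (fC i)).
have g_inj : injective g.
  move=> i j gij; apply: (@ksubset_nth_inj _ _ B).
  by apply: injf; rewrite ?mem_ksubset_nth // -!gE gij.
exists (perm g_inj); apply/ffunP=> x; have [xB|xB] := boolP (x \in val B).
  by have [i <-] := ksubset_nth_onto xB; rewrite map_of_perm_nth permE gE.
by rewrite map_of_perm_out ?fid.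
Qed.

End PermutationMaps.

Lemma zeon_entry_bijection_sum (R : comNzRingType) n k (Y : 'M[R]_n)
    (B C : {set 'I_n}) :
  #|B| = k -> #|C| = k -> zeon_entry k Y B C = bijection_sum Y B C.
Proof.
move=> /eqP cB /eqP cC.
pose b : ksubset n k := Sub B cB; pose c : ksubset n k := Sub C cC.
rewrite -[B]/(val b) -[C]/(val c) zeon_entryE /permanent /bijection_sum.
(* The maps of [b] onto [c] are exactly the image of ['S_k] under the injection [map_of_perm], so
   the sum can be reindexed by permutations. *)
rewrite (eq_bigl (mem (map_of_perm b c @: 'S_k))) => [|f].
  rewrite big_imset /=; last by move=> p q _ _; apply: map_of_perm_inj.
  apply: eq_big => [p|p _]; first by rewrite inE.
  by rewrite -[B]/(val b) big_ksubset; apply: eq_bigr => i _; rewrite mxE map_of_perm_nth.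
apply/idP/imsetP=> [/maps_onto_perm[p <-]|[p _ ->]]; first by exists p.
exact: map_of_perm_onto.
Qed.

Lemma prodrD_subset (R : comNzRingType) (I : finType) (S : {set I})
    (F G : I -> R) :
  \prod_(i in S) (F i + G i) =
  \sum_(A : {set I} | A \subset S) \prod_(i in A) F i * \prod_(i in S :\: A) G i.
Proof.
(* Padding with [0 + 1] off [S] gives a product over all of [I], which [bigA_distr] expands; a set
   [A] not inside [S] then picks up a factor 0. *)
transitivity (\prod_i ((if i \in S then F i else 0)
                       + (if i \in S then G i else 1))).
  by rewrite big_mkcond; apply: eq_bigr => i _; case: ifP; rewrite ?add0r.
rewrite bigA_distr [RHS]big_mkcond; apply: eq_bigr => A _.
case: ifPn => [/subsetP sAS|/subsetPn[x xA xS]]; last first.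
  by rewrite (bigD1 x) //= xA (negPf xS) mul0r.
rewrite [X in _ = X * _]big_mkcond [X in _ = _ * X]big_mkcond -big_split.
apply: eq_bigr => i _ /=; rewrite inE.
by case: ifPn => [/sAS->|_]; rewrite /= ?mulr1 ?mul1r.
Qed.

Lemma prodr_indicator (R : comNzRingType) (I : finType) (A : {set I})
    (P : pred I) :
  \prod_(i in A) (P i)%:R = [forall i in A, P i]%:R :> R.
Proof.
case: forall_inP => [PA|notPA]; first by apply: big1 => i /PA->.
have [x xA /negPf Px] : exists2 x, x \in A & ~~ P x.
  by apply/exists_inP; rewrite -negb_forall_in; apply/forall_inP.
by rewrite (bigD1 x) //= Px mul0r.
Qed.

Lemma bijection_sum_shift (R : comNzRingType) (I : finType) (X : I -> I -> R)
    (s t : R) (S T : {set I}) :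
  #|S| = #|T| ->
  bijection_sum (fun i j => s * (i == j)%:R + t * X i j) S T =
  \sum_(A : {set I} | A \subset S :&: T)
    s ^+ #|A| * t ^+ (#|S| - #|A|) * bijection_sum X (S :\: A) (T :\: A).
Proof.
move=> cST; rewrite /bijection_sum.
under eq_bigr => f _ do rewrite prodrD_subset.
rewrite exchange_big /= (bigID (fun A : {set I} => A \subset T)) /=.
(* If some [x] in [A] is not in [T], then [f x], being in [T], differs from [x], and the diagonal
   factor at [x] vanishes. *)
rewrite [X in _ + X]big1 ?addr0 => [|A /andP[sAS /subsetPn[x xA xT]]]; last first.
  apply: big1 => f /maps_ontoP[fS _]; rewrite (bigD1 x) //=.
  case: eqP => [xfx|_]; last by rewrite mulr0 !mul0r.
  by case/negP: xT; rewrite -fS xfx imset_f ?(subsetP sAS).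
apply: eq_big => [A|A /andP[sAS sAT]]; first by rewrite subsetI.
have sAI : A \subset S :&: T by rewrite subsetI sAS.
rewrite (eq_bigl _ _ (fun f => maps_onto_setD f cST sAI)).
(* The condition that [f] fixes [A] moves into the summand, where it matches the product of the
   indicators over [A]. *)
rewrite big_distrr [RHS]big_mkcondr /=; apply: eq_bigr => f _.
rewrite !big_split /= !prodr_const prodr_indicator.
rewrite cardsD (setIidPr sAS) (eq_forallb_in (P2 := fun x => f x == x)).
  by case: ifP => _; rewrite ?mulr0 ?mul0r // mulr1 mulrA.
by move=> x _; rewrite eq_sym.
Qed.

Theorem theorem2p2 (R : comNzRingType) (n : nat) (n_ge1 : (1 <= n)%N)
    (X : 'M[R]_n) (s t : R) (l : nat) (le_l_n : (l <= n)%N)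
    (S T : {set 'I_n}) (cardS : #|S| = l) (cardT : #|T| = l) :
  zeon_entry l (s *: 1%:M + t *: X) S T =
  \sum_(j < l.+1) s ^+ (l - j) * t ^+ j *
    \sum_(A : {set 'I_n} | (A \subset S :&: T) && (#|A| == l - j)%N)
      zeon_entry j X (S :\: A) (T :\: A).
Proof.
rewrite zeon_entry_bijection_sum //.
transitivity (bijection_sum (fun i j => s * (i == j)%:R + t * X i j) S T).
  by apply: eq_bigr => f _; apply: eq_bigr => i _; rewrite !mxE.
rewrite bijection_sum_shift ?cardS ?cardT //.
(* The sets [A] are grouped by the number [l - #|A|] of factors taken from [t X]; it is at most [l],
   so [inord] keeps its value. *)
rewrite (partition_big (fun A : {set 'I_n} => inord (l - #|A|) : 'I_l.+1) predT) //=.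
apply: eq_bigr => j _; rewrite big_distrr /=.
have lej : (j <= l)%N by rewrite -ltnS.
apply: eq_big => [A|A /andP[sA /eqP jA]].
  case: (boolP (A \subset S :&: T)) => //=; rewrite subsetI => /andP[/subset_leq_card].
  rewrite cardS => leA _; rewrite -val_eqE /= inordK ?ltnS ?leq_subr //.
  by apply/eqP/eqP=> [<-|->]; rewrite subKn.
have [sAS sAT] : A \subset S /\ A \subset T by apply/andP; rewrite -subsetI.
have leA : (#|A| <= l)%N by rewrite -cardS subset_leq_card.
have jE : (l - #|A|)%N = j by rewrite -jA inordK // ltnS leq_subr.
(* Both [S :\: A] and [T :\: A] have [l - #|A| = j] elements, so the dummy value of [zeon_entry]
   does not occur. *)
rewrite zeon_entry_bijection_sum ?cardsD ?(setIidPr sAS) ?(setIidPr sAT) ?cardS ?cardT //.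
by rewrite -jE subKn.
Qed.
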